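(* Let $\xi\in\mathbb{R}^d\setminus\{0\}$. Then $$|v\odot_\xi w|\le \tfrac12 |v|\,|w|\qquad\text{for all } v,w\in\mathbb{C}^d .$$ Moreover, the constant factor $1/2$ on the right-hand side is optimal.
   Context: Here $d$ denotes the space dimension. For $\xi\in\mathbb{R}^d\setminus\{0\}$ put $e_\xi=\xi/|\xi|$. For $a,b\in\mathbb{C}^d$, $e_\xi\cdot a=\sum_j (e_\xi)_j a_j$, and $\pi_{\xi^\perp}a=a-(e_\xi\cdot a)e_\xi$. Let $a\otimes_\xi b=-i(e_\xi\cdot b)(\pi_{\xi^\perp}a)$. The product $\odot_\xi$ is the symmetrized version of $\otimes_\xi$: $$a\odot_\xi b=\frac12\big(a\otimes_\xi b+b\otimes_\xi a\big)=\frac{-i}{2}\Big((e_\xi\cdot b)(\pi_{\xi^\perp}a)+(e_\xi\cdot a)(\pi_{\xi^\perp}b)\Big).$$ $|\cdot|$ is the Euclidean (Hermitian) norm on $\mathbb{C}^d$.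
   Formalization: Optimality of the constant 1/2 is asserted only for dimension d ≥ 2, for each fixed ξ; for d = 1 the projection onto ξ^⊥ is zero, the product vanishes identically, and the constant 0 would do. *)

(* Defs.v *)
From mathcomp Require Import all_boot all_order all_algebra.
From mathcomp Require Import reals.
From mathcomp Require Export complex.

Set Implicit Arguments.
Unset Strict Implicit.
Unset Printing Implicit Defensive.

Import GRing.Theory Num.Theory.
Local Open Scope ring_scope.
Local Open Scope complex_scope.

Section SymmetrizedProduct.
Variables (R : realType) (d : nat).
Implicit Types (xi : 'rV[R]_d) (a b : 'rV[R[i]]_d).

Definition rnorm xi : R := Num.sqrt (\sum_j xi 0 j ^+ 2).

(* The norm that mathcomp-analysis puts on matrices is the sup norm, hence an
   explicit Hermitian norm; [Normc.normc z] is the R-valued modulus. *)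
Definition cnorm a : R := Num.sqrt (\sum_j Normc.normc (a 0 j) ^+ 2).

Definition unitdir xi : 'rV[R]_d := (rnorm xi)^-1 *: xi.

Definition edot xi a : R[i] := \sum_j (unitdir xi 0 j)%:C * a 0 j.

Definition perp_proj xi a : 'rV[R[i]]_d :=
  a - edot xi a *: map_mx (real_complex R) (unitdir xi).

Definition otimes xi a b : 'rV[R[i]]_d :=
  (- 'i%C * edot xi b) *: perp_proj xi a.

Definition odot xi a b : 'rV[R[i]]_d :=
  2^-1 *: (otimes xi a b + otimes xi b a).

End SymmetrizedProduct.

(* Main.v *)
Require Import Defs.
From mathcomp Require Import all_boot all_order all_algebra.
From mathcomp Require Import reals.
From mathcomp Require Import ring lra.
Import Order.TTheory GRing.Theory Num.Theory.
Local Open Scope ring_scope.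

(** Write [e] for the unit vector along [xi], and split [v] and [w] into their
    components [alpha], [beta] along [e] and their projections [v'], [w'] onto
    the orthogonal complement of [e].  Then
    [odot xi v w = (- i / 2) (beta v' + alpha w')], so the triangle inequality
    bounds its norm by [(|beta| |v'| + |alpha| |w'|) / 2] ([odotE],
    [cnorm_triangle]).  This is half of the inner product in the plane of the
    pairs [(|alpha|, |v'|)] and [(|w'|, |beta|)]; by Pythagoras
    ([cnorm_pythagoras]) these pairs have lengths [|v|] and [|w|], and
    Cauchy-Schwarz in the plane gives the estimate.

    Equality holds for [v = e] and any [w] orthogonal to [e], since then
    [odot xi v w = (- i / 2) w].  In dimension at least two such a [w] can be
    chosen nonzero ([exists_orthogonal]), which makes [1 / 2] optimal. *)

(** The double sum of [(x i * y j - x j * y i) ^+ 2] is twice the gap between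
    the two sides. *)
Lemma cauchy_schwarz_sum (R : realFieldType) (I : finType) (x y : I -> R) :
  (\sum_i x i * y i) ^+ 2 <= (\sum_i x i ^+ 2) * (\sum_i y i ^+ 2).
Proof.
have gap_ge0 : 0 <= \sum_i \sum_j (x i * y j - x j * y i) ^+ 2.
  by apply: sumr_ge0 => i _; apply: sumr_ge0 => j _; apply: sqr_ge0.
have prodE (f g : I -> R) :
    (\sum_i f i) * (\sum_j g j) = \sum_i \sum_j f i * g j.
  by rewrite big_distrlr.
have gapE : \sum_i \sum_j (x i * y j - x j * y i) ^+ 2 =
    (\sum_i x i ^+ 2) * (\sum_i y i ^+ 2)
    + (\sum_i y i ^+ 2) * (\sum_i x i ^+ 2)
    - (\sum_i x i * y i) * (\sum_i x i * y i) *+ 2.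
  rewrite !prodE -sumrMnl -!big_split -sumrB /=; apply: eq_bigr => i _.
  rewrite -sumrMnl -!big_split -sumrB /=; apply: eq_bigr => j _.
  by ring.
by move: gap_ge0; rewrite gapE expr2; lra.
Qed.

Lemma sum_sqr_eq0 (R : realFieldType) (I : finType) (x : I -> R) :
  \sum_i x i ^+ 2 = 0 -> forall i, x i = 0.
Proof.
move=> sum0 i; apply/eqP; rewrite -sqrf_eq0; apply/eqP.
by apply: (psumr_eq0P _ sum0) => // j _; apply: sqr_ge0.
Qed.

Section HermitianNorm.
Variables (R : realType) (d : nat).
Implicit Types (a b : 'rV[R[i]]_d) (c z : R[i]).

Lemma normc_ge0 z : 0 <= Normc.normc z.
Proof. by case: z => x y; apply: sqrtr_ge0. Qed.

Lemma sqr_normcE z : Normc.normc z ^+ 2 = complex.Re z ^+ 2 + complex.Im z ^+ 2.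
Proof. by case: z => x y; rewrite /= sqr_sqrtr // addr_ge0 ?sqr_ge0. Qed.

Lemma normc_real (x : R) : Normc.normc (real_complex R x) = `|x|.
Proof. by rewrite /= expr0n addr0 sqrtr_sqr. Qed.

Lemma cnorm_ge0 a : 0 <= cnorm a.
Proof. exact: sqrtr_ge0. Qed.

Lemma sqr_cnorm a : cnorm a ^+ 2 = \sum_j Normc.normc (a 0 j) ^+ 2.
Proof. by rewrite sqr_sqrtr // sumr_ge0 // => j _; apply: sqr_ge0. Qed.

Lemma cnorm_gt0 a : a != 0 -> 0 < cnorm a.
Proof.
move=> a0; rewrite lt_def cnorm_ge0 andbT; apply: contraNneq a0 => na0.
have sum0 : \sum_j Normc.normc (a 0 j) ^+ 2 = 0 by rewrite -sqr_cnorm na0 expr0n.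
apply/eqP/rowP => j; rewrite mxE; apply: Normc.eq0_normc.
exact: (sum_sqr_eq0 _ _ _ sum0).
Qed.

Lemma cnormZ c a : cnorm (c *: a) = Normc.normc c * cnorm a.
Proof.
apply/eqP; rewrite -(eqrXn2 (n := 2)) ?mulr_ge0 ?normc_ge0 ?cnorm_ge0 //.
rewrite exprMn !sqr_cnorm mulr_sumr; apply/eqP/eq_bigr => j _.
by rewrite mxE Normc.normcM exprMn.
Qed.

(** The triangle inequality in each coordinate reduces this to the real
    Cauchy-Schwarz inequality for the moduli of the coordinates. *)
Lemma cnorm_triangle a b : cnorm (a + b) <= cnorm a + cnorm b.
Proof.
rewrite -ler_sqr ?nnegrE ?addr_ge0 ?cnorm_ge0 // sqrrD !sqr_cnorm.
set x := fun j => Normc.normc (a 0 j); set y := fun j => Normc.normc (b 0 j).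
have coord : \sum_j Normc.normc ((a + b) 0 j) ^+ 2 <=
    \sum_j x j ^+ 2 + (\sum_j x j * y j) *+ 2 + \sum_j y j ^+ 2.
  rewrite -sumrMnl -!big_split /=; apply: ler_sum => j _.
  rewrite -sqrrD ler_sqr ?nnegrE ?addr_ge0 ?normc_ge0 // mxE.
  exact: le_normcD.
apply: (le_trans coord); rewrite lerD2r lerD2l lerMn2r /=.
rewrite -ler_sqr ?nnegrE ?mulr_ge0 ?cnorm_ge0 //; last first.
  by apply: sumr_ge0 => j _; rewrite mulr_ge0 ?normc_ge0.
by rewrite exprMn !sqr_cnorm; apply: cauchy_schwarz_sum.
Qed.

End HermitianNorm.

Section Direction.
Variables (R : realType) (d : nat) (xi : 'rV[R]_d).
Hypothesis xi_neq0 : xi != 0.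
Implicit Types (a b v w : 'rV[R[i]]_d).

Local Notation e := (unitdir xi).
Local Notation eC := (map_mx (real_complex R) e).

Lemma rnorm_gt0 : 0 < rnorm xi.
Proof.
rewrite lt_def sqrtr_ge0 andbT sqrtr_eq0 -ltNge lt_def.
rewrite sumr_ge0 ?andbT => [|j _]; last exact: sqr_ge0.
apply: contraNneq xi_neq0 => sum0; apply/eqP/rowP => j; rewrite mxE.
exact: (sum_sqr_eq0 _ _ _ sum0).
Qed.

Lemma sum_sqr_unitdir : \sum_j e 0 j ^+ 2 = 1.
Proof.
have sqr_rnorm : rnorm xi ^+ 2 = \sum_j xi 0 j ^+ 2.
  by rewrite sqr_sqrtr // sumr_ge0 // => j _; apply: sqr_ge0.
transitivity ((rnorm xi)^-1 ^+ 2 * rnorm xi ^+ 2).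
  by rewrite sqr_rnorm mulr_sumr; apply: eq_bigr => j _; rewrite mxE exprMn.
by rewrite -exprMn mulVf ?expr1n // gt_eqF // rnorm_gt0.
Qed.

Lemma cnorm_unitdir : cnorm eC = 1.
Proof.
rewrite /cnorm -[RHS]sqrtr1 -sum_sqr_unitdir; congr Num.sqrt.
by apply: eq_bigr => j _; rewrite mxE normc_real -normrX ger0_norm ?sqr_ge0.
Qed.

Lemma edot_unitdir : edot xi eC = 1.
Proof.
rewrite /edot -[RHS](rmorph1 (real_complex R)) -sum_sqr_unitdir rmorph_sum.
by apply: eq_bigr => j _; rewrite [map_mx _ _ _ _]mxE -rmorphM expr2.
Qed.

(** Since [e] is real, the real and imaginary parts of [edot xi a] are the
    inner products of [e] with the real and imaginary parts of [a]. *)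
Lemma cnorm_pythagoras a :
  cnorm a ^+ 2 = Normc.normc (edot xi a) ^+ 2 + cnorm (perp_proj xi a) ^+ 2.
Proof.
have ReE : complex.Re (edot xi a) = \sum_j e 0 j * complex.Re (a 0 j).
  rewrite /edot (raddf_sum (@complex.Re R : Rcomplex R -> R)) /=.
  by apply: eq_bigr => j _; case: (a 0 j) => x y /=; ring.
have ImE : complex.Im (edot xi a) = \sum_j e 0 j * complex.Im (a 0 j).
  rewrite /edot (raddf_sum (@complex.Im R : Rcomplex R -> R)) /=.
  by apply: eq_bigr => j _; case: (a 0 j) => x y /=; ring.
rewrite !sqr_cnorm sqr_normcE.
set p := complex.Re (edot xi a) in ReE *.
set q := complex.Im (edot xi a) in ImE *.
have coord j : Normc.normc (perp_proj xi a 0 j) ^+ 2 =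
    Normc.normc (a 0 j) ^+ 2 + (p ^+ 2 + q ^+ 2) * e 0 j ^+ 2
    - (p *+ 2 * (e 0 j * complex.Re (a 0 j))
       + q *+ 2 * (e 0 j * complex.Im (a 0 j))).
  rewrite !sqr_normcE !mxE /p /q.
  by case: (a 0 j) (edot xi a) => [x y] [s t] /=; ring.
rewrite (eq_bigr _ (fun j _ => coord j)) sumrB !big_split /= -!mulr_sumr.
rewrite -ReE -ImE sum_sqr_unitdir.
by ring.
Qed.

Lemma odotE v w :
  odot xi v w =
  (- 'i%C * 2^-1) *: (edot xi w *: perp_proj xi v + edot xi v *: perp_proj xi w).
Proof.
by rewrite /odot /otimes -!scalerA -scalerDr scalerA mulrC -scalerA.
Qed.

Lemma normc_half_i : Normc.normc (- 'i%C * 2^-1 : R[i]) = 2^-1.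
Proof.
rewrite Normc.normcM Normc.normcV normcN.
have -> : (2 : R[i]) = real_complex R 2 by rewrite rmorph_nat.
by rewrite normc_real /= expr0n expr1n add0r sqrtr1 mul1r normr_nat.
Qed.

Lemma cnorm_odot_le v w : cnorm (odot xi v w) <= 2^-1 * cnorm v * cnorm w.
Proof.
rewrite odotE cnormZ normc_half_i -mulrA ler_pM2l ?invr_gt0 ?ltr0n //.
apply: (le_trans (cnorm_triangle _ _ _ _)); rewrite !cnormZ.
rewrite -ler_sqr ?nnegrE ?addr_ge0 ?mulr_ge0 ?normc_ge0 ?cnorm_ge0 //.
rewrite exprMn (cnorm_pythagoras v) (cnorm_pythagoras w).
set t := Normc.normc (edot xi v); set p := cnorm (perp_proj xi v).
set s := Normc.normc (edot xi w); set q := cnorm (perp_proj xi w).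
(* The gap is the square of the determinant of the planar vectors (t, p) and
   (q, s). *)
have := sqr_ge0 (t * s - p * q).
by nra.
Qed.

(** With two coordinate directions available, rotating the projection of [xi]
    onto a coordinate plane by a right angle gives the vector; the plane has to
    contain an axis on which [xi] does not vanish. *)
Lemma exists_orthogonal :
  (1 < d)%N -> exists2 w : 'rV[R[i]]_d, w != 0 & edot xi w = 0.
Proof.
move=> d_gt1.
have [k xik] : exists k, xi 0 k != 0.
  by apply/rV0Pn.
have [l lk] : exists l : 'I_d, l != k.
  apply/existsP; rewrite -negb_forall; apply/negP => /forallP all_k.
  have := subset_leq_card (A := 'I_d) (B := pred1 k).
  rewrite card1 card_ord leqNgt d_gt1 => /(_ _)/negP [] //.
  by apply/subsetP => l _; rewrite inE.
pose w : 'rV[R[i]]_d := real_complex R (e 0 k) *: delta_mx 0 l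
                         - real_complex R (e 0 l) *: delta_mx 0 k.
exists w.
  apply/rV0Pn; exists l; rewrite !mxE !eqxx (negbTE lk) mulr1 mulr0 subr0.
  rewrite fmorph_eq0 mulf_neq0 // invr_eq0 gt_eqF //.
  exact: rnorm_gt0.
rewrite /edot (bigD1 l) //= (bigD1 k) 1?eq_sym //= big1 => [|j /andP[jl jk]].
  rewrite !mxE !eqxx (negbTE lk) eq_sym (negbTE lk) /=.
  by ring.
by rewrite !mxE (negbTE jl) (negbTE jk) !mulr0 subr0 mulr0.
Qed.

Lemma cnorm_odot_orthogonal w :
  edot xi w = 0 -> cnorm (odot xi eC w) = 2^-1 * cnorm w.
Proof.
move=> ew; rewrite odotE cnormZ normc_half_i ew scale0r add0r edot_unitdir.
by rewrite scale1r /perp_proj ew scale0r subr0.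
Qed.

End Direction.

Theorem lemma2p1 (R : realType) (d : nat) (xi : 'rV[R]_d) (hxi : xi != 0) :
  (forall v w : 'rV[R[i]]_d,
      cnorm (odot xi v w) <= 2^-1 * cnorm v * cnorm w) /\
  ((1 < d)%N ->
   forall c : R,
     (forall v w : 'rV[R[i]]_d,
         cnorm (odot xi v w) <= c * cnorm v * cnorm w) ->
     2^-1 <= c).
Proof.
split=> [v w | d_gt1 c le_c]; first exact: cnorm_odot_le.
have [w w0 ew] := exists_orthogonal R d xi hxi d_gt1.
have := le_c (map_mx (real_complex R) (unitdir xi)) w.
rewrite cnorm_odot_orthogonal // cnorm_unitdir // mulr1.
by rewrite ler_pM2r // cnorm_gt0.
Qed.
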